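(* For every input function $u_1\in\mathbb{L}_1^{n_u}$ one has $X[u_1]=X_{\rm F}[u_1]$, that is, $X[u_1](t)=X_{\rm F}[u_1](t)$ for all $t\in[0,T]$.
   Context: Let $T>0$, $x_0\in\mathbb{R}^{n_x}$, $f:\mathbb{R}^{n_x}\times\mathbb{R}^{n_u}\times\mathbb{R}^{n_u}\to\mathbb{R}^{n_x}$, a control constraint set $\mathbb{U}_2\subseteq\mathbb{R}^{n_u}$, and state constraint sets $\mathbb{X}_2(t)\subseteq\mathbb{R}^{n_x}$, $t\in[0,T]$, be given. $\mathbb{L}_1^{n}$ denotes the set of $n$-dimensional $L_1$-integrable functions and $\mathbb{W}_{1,1}^{n}$ the associated Sobolev space of weakly differentiable functions with $L_1$-integrable derivatives (identified with their absolutely continuous representatives) on the relevant time interval. In the definitions below the differential equation and the constraint $u_2(\tau)\in\mathbb{U}_2$ are understood for almost every $\tau$, and the state constraints for every $\tau$. For $u_1\in\mathbb{L}_1^{n_u}$ let $\mathbb{X}[u_1]$ be the set of all $x\in\mathbb{W}^{n_x}_{1,1}$ on $[0,T]$ for which there exists $u_2\in\mathbb{L}_1^{n_u}$ such that for $\tau\in[0,T]$: $\dot x(\tau)=f(x(\tau),u_1(\tau),u_2(\tau))$, $x(\tau)\in\mathbb{X}_2(\tau)$, $u_2(\tau)\in\mathbb{U}_2$, and $x(0)=x_0$. The reachable set is $X[u_1](t)=\{x(t)\mid x\in\mathbb{X}[u_1]\}$ for $t\in[0,T]$. The backward set $X_{\rm B}[u_1](t)$, $t\in[0,T]$, is the set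 of all $\xi\in\mathbb{R}^{n_x}$ for which there exist $x\in\mathbb{W}^{n_x}_{1,1}$ and $u_2\in\mathbb{L}_1^{n_u}$ such that for $\tau\in[t,T]$: $\dot x(\tau)=f(x(\tau),u_1(\tau),u_2(\tau))$, $x(\tau)\in\mathbb{X}_2(\tau)$, $u_2(\tau)\in\mathbb{U}_2$, and $x(t)=\xi$. The constrained forward reachable set $X_{\rm F}[u_1](t)$, $t\in[0,T]$, is the set of all $\xi\in\mathbb{R}^{n_x}$ for which there exist $x\in\mathbb{W}^{n_x}_{1,1}$ and $u_2\in\mathbb{L}_1^{n_u}$ such that for $\tau\in[0,t]$: $\dot x(\tau)=f(x(\tau),u_1(\tau),u_2(\tau))$, $x(\tau)\in X_{\rm B}[u_1](\tau)$, $u_2(\tau)\in\mathbb{U}_2$, and $x(0)=x_0$, $x(t)=\xi$. *)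

(* Defs.v *)
From HB Require Import structures.
From mathcomp Require Import all_boot all_order all_algebra.
From mathcomp Require Import all_classical all_reals all_analysis.

Set Implicit Arguments.
Unset Strict Implicit.
Unset Printing Implicit Defensive.

Import Order.TTheory GRing.Theory Num.Theory.
Import numFieldNormedType.Exports.

Local Open Scope classical_set_scope.
Local Open Scope ring_scope.

(* Functions of time are total functions on [R]; every definition below that
   mentions an interval [[a, b]] only depends on the values taken there.
   An element of L_1 is a Borel representative of its class, and
   [lebesgue_measure] is the Borel one: every class has such a representative,
   and [{ae _, _}] accepts any subset of a Borel null set. *)

Definition L1 (R : realType) (n : nat) (a b : R) (u : R -> 'cV[R]_n) : Prop :=
  forall i : 'I_n,
    (@lebesgue_measure R).-integrable `[a, b] (EFin \o (fun t => u t i 0)).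

Definition absolutely_continuous (R : realType) (a b : R) (x : R -> R) : Prop :=
  forall e : R, 0 < e ->
  exists2 d : R, 0 < d &
  forall (m : nat) (l r : 'I_m -> R),
    (forall k, a <= l k /\ l k <= r k /\ r k <= b) ->
    trivIset setT (fun k => `]l k, r k[%classic) ->
    \sum_(k < m) (r k - l k) < d ->
    \sum_(k < m) `|x (r k) - x (l k)| < e.

Definition test_function (R : realType) (a b : R) (phi : R -> R) : Prop :=
  [/\ (forall (k : nat) (t : R), derivable (derive1n k phi) t 1),
      compact (closure [set t | phi t != 0]) &
      closure [set t | phi t != 0] `<=` `]a, b[].

Definition weak_derivative (R : realType) (a b : R) (x dx : R -> R) : Prop :=
  forall phi : R -> R, test_function a b phi ->
    \int[@lebesgue_measure R]_(t in `]a, b[) (x t * derive1 phi t) =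
    - \int[@lebesgue_measure R]_(t in `]a, b[) (dx t * phi t).

(* [x] is the absolutely continuous representative of an element of W_{1,1} on
   [[a, b]], and [dx] is (a representative of) its weak derivative.  Local
   integrability of [x] follows from its continuity.  For [a = b] all
   three conditions are void. *)
Definition W11 (R : realType) (n : nat) (a b : R) (x dx : R -> 'cV[R]_n) :
    Prop :=
  [/\ (forall i : 'I_n, absolutely_continuous a b (fun t => x t i 0)),
      L1 a b dx &
      forall i : 'I_n,
        weak_derivative a b (fun t => x t i 0) (fun t => dx t i 0)].

(* The conditions on [(x, u2)] shared by the three sets below: on [[a, b]], [x]
   is a W_{1,1} solution of the differential equation for the inputs [u1] and
   [u2], with control constraint [U2] and state constraint [X]. *)
Definition feasible (R : realType) (nx nu : nat)
    (f : 'cV[R]_nx -> 'cV[R]_nu -> 'cV[R]_nu -> 'cV[R]_nx)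
    (U2 : set 'cV[R]_nu) (X : R -> set 'cV[R]_nx) (u1 : R -> 'cV[R]_nu)
    (a b : R) (x : R -> 'cV[R]_nx) (u2 : R -> 'cV[R]_nu) : Prop :=
  L1 a b u2 /\
  exists dx : R -> 'cV[R]_nx,
    [/\ W11 a b x dx,
        {ae @lebesgue_measure R, forall t : R,
           a <= t <= b -> dx t = f (x t) (u1 t) (u2 t)},
        {ae @lebesgue_measure R, forall t : R, a <= t <= b -> U2 (u2 t)} &
        forall t : R, a <= t <= b -> X t (x t)].

Definition trajectories (R : realType) (nx nu : nat) (T : R) (x0 : 'cV[R]_nx)
    (f : 'cV[R]_nx -> 'cV[R]_nu -> 'cV[R]_nu -> 'cV[R]_nx)
    (U2 : set 'cV[R]_nu) (X2 : R -> set 'cV[R]_nx) (u1 : R -> 'cV[R]_nu) :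
    set (R -> 'cV[R]_nx) :=
  [set x | exists u2 : R -> 'cV[R]_nu,
     feasible f U2 X2 u1 0 T x u2 /\ x 0 = x0].

Definition reachable_set (R : realType) (nx nu : nat) (T : R) (x0 : 'cV[R]_nx)
    (f : 'cV[R]_nx -> 'cV[R]_nu -> 'cV[R]_nu -> 'cV[R]_nx)
    (U2 : set 'cV[R]_nu) (X2 : R -> set 'cV[R]_nx) (u1 : R -> 'cV[R]_nu)
    (t : R) : set 'cV[R]_nx :=
  [set x t | x in trajectories T x0 f U2 X2 u1].

Definition backward_set (R : realType) (nx nu : nat) (T : R)
    (f : 'cV[R]_nx -> 'cV[R]_nu -> 'cV[R]_nu -> 'cV[R]_nx)
    (U2 : set 'cV[R]_nu) (X2 : R -> set 'cV[R]_nx) (u1 : R -> 'cV[R]_nu)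
    (t : R) : set 'cV[R]_nx :=
  [set xi | exists (x : R -> 'cV[R]_nx) (u2 : R -> 'cV[R]_nu),
     feasible f U2 X2 u1 t T x u2 /\ x t = xi].

Definition forward_set (R : realType) (nx nu : nat) (T : R) (x0 : 'cV[R]_nx)
    (f : 'cV[R]_nx -> 'cV[R]_nu -> 'cV[R]_nu -> 'cV[R]_nx)
    (U2 : set 'cV[R]_nu) (X2 : R -> set 'cV[R]_nx) (u1 : R -> 'cV[R]_nu)
    (t : R) : set 'cV[R]_nx :=
  [set xi | exists (x : R -> 'cV[R]_nx) (u2 : R -> 'cV[R]_nu),
     [/\ feasible f U2 (backward_set T f U2 X2 u1) u1 0 t x u2,
         x 0 = x0 & x t = xi]].

(* Main.v *)
Require Import Defs.
From mathcomp Require Import all_boot all_order all_algebra.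
From mathcomp Require Import all_classical all_reals all_analysis.
From mathcomp Require Import measurable_realfun ring lra.

Import Order.TTheory GRing.Theory Num.Theory.
Import numFieldNormedType.Exports.

Local Open Scope classical_set_scope.
Local Open Scope ring_scope.

(** Both inclusions only cut and paste trajectories. A trajectory on [[0, T]],
    restricted to [[tau, T]], witnesses that its value at [tau] lies in the
    backward set, so its restriction to [[0, t]] is admissible for the forward
    set. Conversely, a point reached by the forward set at time [t] lies in the
    backward set, hence is the starting point of a feasible trajectory on
    [[t, T]]; pasting it after the given one yields a trajectory on [[0, T]].
    The state constraints survive because the backward set at [tau] is
    contained in [X2 tau].

    Restriction ([feasibleS]) is easy: a test function on a smaller interval is
    one on the larger interval. The content is in pasting ([feasible_concat]),
    and there in the weak derivative ([weak_derivative_glue]): a test function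
    [phi] on [[a, b]] need not vanish at the junction [t], so the two given
    identities cannot be applied to it directly. Take a smooth step [H], equal
    to 0 before -1 and to 1 after 1, and put [s = k (tau - t)]. Then
      [phi = phi (1 - H (s + 2)) + phi H (s - 2) + phi (H (s + 2) - H (s - 2))]
    where the first term is a test function left of [t] and the second one
    right of [t]. Only the third term, which lives on [|tau - t| <= 3 / k],
    contributes to the defect of the identity for [phi], that is, to
    [int z phi' + int dz phi] ([defect_localized]). Its
    contribution is arbitrarily small for large [k] ([defect_bump_small]): its
    derivative is of order [k] on an interval of length [6 / k], but has
    integral 0, so it only sees the oscillation of the continuous function [z]
    near [t]; and the integral of [|dz|] over short intervals is small.

    The step [H] is obtained from the test function at hand rather than from
    an explicit function such as [exp (- 1 / x)]: if [phi] is not identically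
    zero, a primitive of [phi ^ 2] is smooth, constant on either side of the
    support, and not globally constant; [H] is its rescaling ([smooth_step]).
    If no nonzero [phi] is available there is nothing to prove. *)

Set Implicit Arguments.
Unset Strict Implicit.
Unset Printing Implicit Defensive.

(** * Smooth functions *)

Definition smooth (R : realType) (f : R -> R) : Prop :=
  forall (k : nat) (t : R), derivable (derive1n k f) t 1.

Lemma smoothP (R : realType) (f : R -> R) :
  smooth f <-> (forall t, derivable f t 1) /\ smooth (derive1 f).
Proof.
split=> [sf|[df sf] [|k] t]; last 2 first.
- exact: df.
- by rewrite derive1Sn; exact: sf.
by split=> [t|k t]; [exact: (sf 0%N)|rewrite -derive1Sn; exact: sf].
Qed.

(** Smoothness as a greatest fixpoint: to prove it for a whole class of
    functions, only first derivatives have to be computed. *)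
Lemma smooth_coind (R : realType) (P : (R -> R) -> Prop) :
  (forall f, P f -> (forall t, derivable f t 1) /\ P (derive1 f)) ->
  forall f, P f -> smooth f.
Proof.
move=> HP f Pf k; elim: k f Pf => [|k IH] f Pf t.
  exact: (HP f Pf).1.
by rewrite derive1Sn; apply: IH; exact: (HP f Pf).2.
Qed.

(** Closure of the smooth functions under the operations below. This class is
    stable under differentiation, since the product and chain rules stay inside
    it, so [smooth_coind] gives all closure properties of [smooth] at once,
    without a Leibniz formula for higher derivatives. *)
Inductive smooth_expr (R : realType) : (R -> R) -> Prop :=
| SmoothSelf f : smooth f -> smooth_expr f
| SmoothCst c : smooth_expr (fun=> c)
| SmoothAdd f g : smooth_expr f -> smooth_expr g ->
    smooth_expr (fun x => f x + g x)
| SmoothMul f g : smooth_expr f -> smooth_expr g ->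
    smooth_expr (fun x => f x * g x)
| SmoothAffine f a b : smooth_expr f -> smooth_expr (fun x => f (a * x + b)).

Lemma is_derive_affine (R : realType) (f : R -> R) (a b x : R) :
  derivable f (a * x + b) 1 ->
  is_derive x 1 (fun y => f (a * y + b)) (a * (derive1 f) (a * x + b)).
Proof.
move=> df.
have h : is_derive x 1 (fun y : R => a * y + b) a.
  by apply: is_derive_eq; rewrite /GRing.scale/=; ring.
rewrite mulrC; apply: (is_derive1_comp _ h).
by rewrite derive1E; exact: derivableP.
Qed.

Lemma smooth_exprP (R : realType) (f : R -> R) : smooth_expr f -> smooth f.
Proof.
move: f; apply: smooth_coind => f; elim=> {f}
  [f sf|c|f g _ [df sf] _ [dg sg]|f g ef [df sf] eg [dg sg]|f a b ef [df sf]].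
- by split; [exact: (sf 0%N)|apply: SmoothSelf; exact: ((smoothP f).1 sf).2].
- split=> [t|]; first exact: derivable_cst.
  rewrite (_ : derive1 _ = fun=> 0); first exact: SmoothCst.
  by apply/funext => t; rewrite derive1_cst.
- split=> [t|]; first exact: derivableD.
  rewrite (_ : derive1 _ = fun x => derive1 f x + derive1 g x).
    exact: SmoothAdd.
  by apply/funext => t; rewrite !derive1E deriveD.
- split=> [t|]; first exact: derivableM.
  rewrite (_ : derive1 _ = fun x => f x * derive1 g x + g x * derive1 f x).
    by apply: SmoothAdd; apply: SmoothMul.
  by apply/funext => t; rewrite !derive1E deriveM.
- split=> [t|]; first by have [] := is_derive_affine (df (a * t + b)).
  rewrite (_ : derive1 _ = fun x => a * (derive1 f) (a * x + b)).
    by apply: SmoothMul; [exact: SmoothCst|exact: SmoothAffine].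
  apply/funext => t; rewrite derive1E.
  by have h := is_derive_affine (df (a * t + b)); rewrite derive_val.
Qed.

Lemma smoothD (R : realType) (f g : R -> R) :
  smooth f -> smooth g -> smooth (fun x => f x + g x).
Proof.
by move=> sf sg; apply/smooth_exprP/SmoothAdd; exact: SmoothSelf.
Qed.

Lemma smoothM (R : realType) (f g : R -> R) :
  smooth f -> smooth g -> smooth (fun x => f x * g x).
Proof.
by move=> sf sg; apply/smooth_exprP/SmoothMul; exact: SmoothSelf.
Qed.

Lemma smooth_cst (R : realType) (c : R) : smooth (fun=> c).
Proof. exact/smooth_exprP/SmoothCst. Qed.

Lemma smooth_affine (R : realType) (f : R -> R) (a b : R) :
  smooth f -> smooth (fun x => f (a * x + b)).
Proof. by move=> sf; apply/smooth_exprP/SmoothAffine/SmoothSelf. Qed.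

Lemma smoothB (R : realType) (f g : R -> R) :
  smooth f -> smooth g -> smooth (fun x => f x - g x).
Proof.
move=> sf sg.
have := smoothD sf (smoothM (@smooth_cst R (-1)) sg); congr smooth.
by apply/funext => x; rewrite mulN1r.
Qed.

Lemma smooth_derivable (R : realType) (f : R -> R) (t : R) :
  smooth f -> derivable f t 1.
Proof. by move/(_ 0%N); apply. Qed.

Lemma smooth_derive (R : realType) (f : R -> R) :
  smooth f -> smooth (derive1 f).
Proof. by move/smoothP => []. Qed.

Lemma smooth_continuous (R : realType) (f : R -> R) : smooth f -> continuous f.
Proof.
move=> sf t; apply/differentiable_continuous/derivable1_diffP.
exact: smooth_derivable.
Qed.

Lemma derive1_eq0_outside (R : realType) (c d : R) (f : R -> R) :
  (forall x, f x != 0 -> c <= x <= d) ->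
  forall x, (derive1 f) x != 0 -> c <= x <= d.
Proof.
move=> supp x; apply: contra_neqT => xcd.
rewrite derive1E (near_eq_derive (g := cst 0)) ?derive_cst//.
have : nbhs x (~` `[c, d]%classic).
  apply: open_nbhs_nbhs; split; last by rewrite /= in_itv/=; exact/negP.
  exact/closed_openC/itv_closed.
apply: filterS => y /=; rewrite in_itv/= => ycd.
by apply/eqP; apply: contrapT => /negP/supp.
Qed.

Lemma bounded_of_support (R : realType) (c d : R) (f : R -> R) :
  continuous f -> (forall x, f x != 0 -> c <= x <= d) ->
  exists M : R, 0 <= M /\ forall x, `|f x| <= M.
Proof.
move=> cf supp.
have : compact (f @` `[c, d]%classic).
  apply: continuous_compact; last exact: segment_compact.
  exact: continuous_subspaceT.
move=> /compact_bounded[M [_ HM]].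
exists (`|M| + 1); split=> [|x]; first by rewrite addr_ge0.
have [->|fx0] := eqVneq (f x) 0; first by rewrite normr0 addr_ge0.
apply: (HM (`|M| + 1)) => /=.
  by rewrite ltr_pwDr// ler_norm.
by exists x => //=; rewrite in_itv/=; exact: supp.
Qed.

(** A compact subset of an open interval lies in a segment of it. With [c] and
    [d] explicit, closures are not met again. When [phi] vanishes, [c <= d] may
    fail, which makes the statement valid for empty intervals too. *)
Lemma test_functionP (R : realType) (a b : R) (phi : R -> R) :
  test_function a b phi <->
  smooth phi /\ exists c d : R, [/\ a < c, d < b &
    forall x, phi x != 0 -> c <= x <= d].
Proof.
split=> [[sphi cphi sub]|[sphi [c [d [ac db supp]]]]].
  split=> //; set S := closure _ in cphi sub.
  have SP x : phi x != 0 -> S x by move=> h; exact: subset_closure.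
  have [S0|S0] := pselect (S !=set0); last first.
    exists (a + 1), (b - 1); split; rewrite ?ltrDl ?ltrBlDr ?ltrDl//.
    by move=> x /SP Sx; exfalso; apply: S0; exists x.
  have cid : {within S, continuous (id : R -> R)}.
    by apply: continuous_subspaceT => x; exact: cvg_id.
  have [d dS dmax] := compact_EVT_max S0 cphi cid.
  have [c cS cmin] := compact_EVT_min S0 cphi cid.
  exists c, d; split.
  - by move: cS; rewrite inE => /sub/=; rewrite in_itv/= => /andP[].
  - by move: dS; rewrite inE => /sub/=; rewrite in_itv/= => /andP[].
  - by move=> x /SP Sx; rewrite cmin ?inE//= dmax ?inE.
have Scd : closure [set t | phi t != 0] `<=` `[c, d].
  rewrite [X in _ `<=` X](closure_id _).1; last exact: itv_closed.
  by apply: closureS => x /supp; rewrite /= in_itv.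
split=> //.
  apply: subclosed_compact Scd; last exact: segment_compact.
  exact: closed_closure.
apply: (subset_trans Scd) => x /=; rewrite !in_itv/= => /andP[cx xd].
by rewrite (lt_le_trans ac cx) (le_lt_trans xd db).
Qed.

(** * A smooth step made from a test function *)

(** [F] is the primitive of [psi] from minus infinity and [m] its total mass,
    which is positive because otherwise [F], hence [psi], would vanish. *)
Lemma smooth_plateau (R : realType) (c d x0 : R) (psi : R -> R) :
  smooth psi -> (forall x, 0 <= psi x) ->
  (forall x, psi x != 0 -> c <= x <= d) -> psi x0 != 0 ->
  exists (F : R -> R) (m : R), [/\ 0 < m, smooth F, forall x, 0 <= F x <= m,
    forall x : R, x < c -> F x = 0 & forall x : R, d < x -> F x = m].
Proof.
move=> spsi psi0 supp px0.
pose mu := @lebesgue_measure R.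
have ipsi : mu.-integrable setT (EFin \o psi).
  have h : mu.-integrable `[c, d] (EFin \o psi).
    apply: continuous_compact_integrable; first exact: segment_compact.
    exact/continuous_subspaceT/smooth_continuous.
  have /(integrable_mkcond _ _).1 := h => /(_ (measurable_itv _)).
  congr (_.-integrable _ _); apply/funext => x.
  rewrite patchE; case: ifPn => //; rewrite notin_setE/= in_itv/= => xcd.
  by congr EFin; apply/esym/eqP; apply: contrapT => /negP/supp.
have imu (A : set R) : measurable A -> mu.-integrable A (EFin \o psi).
  by move=> mA; apply: integrableS ipsi.
pose F x := \int[mu]_(t in `]-oo, x]) psi t.
pose m := \int[mu]_t psi t.
have F0 x : 0 <= F x by apply: Rintegral_ge0.
have Fm x : F x <= m.
  rewrite /F Rintegral_mkcond /m; apply: le_Rintegral => //.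
    rewrite -restrict_EFin; apply/integrable_restrict => //=.
    by rewrite setTI; exact: imu.
  by move=> t _; rewrite patchE; case: ifPn.
have dF x : derivable F x 1 /\ derive1 F x = psi x.
  apply: (@continuous_FTC1 _ psi (BInfty _ true) x (x + 1)).
  - by rewrite ltrDl.
  - exact: imu.
  - by rewrite ltNyr.
  - exact: smooth_continuous.
have F'E : derive1 F = psi by apply/funext => x; exact: (dF x).2.
exists F, m; split.
- rewrite lt0r (le_trans (F0 0) (Fm 0)) andbT; apply/eqP => m0.
  have FE : F = cst 0.
    by apply/funext => x; apply/eqP; rewrite eq_le F0 -[X in _ <= X]m0 Fm.
  by move: px0; rewrite -F'E FE derive1_cst eqxx.
- apply/smoothP; rewrite F'E; split=> // t; exact: (dF t).1.
- by move=> x; rewrite F0 Fm.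
- move=> x xc; rewrite /F (_ : 0 = \int[mu]_(t in `]-oo, x]) 0); last first.
    by rewrite Rintegral_cst ?mul0r.
  apply: eq_Rintegral => t; rewrite inE/= in_itv/= => tx.
  apply/eqP; apply: contraT => /supp /andP[ct _].
  by move: (le_lt_trans ct (le_lt_trans tx xc)); rewrite ltxx.
- move=> x dx; rewrite /F /m Rintegral_mkcond; apply: eq_Rintegral => t _.
  rewrite patchE; case: ifPn => //; rewrite notin_setE/= in_itv/= => tx.
  apply/esym/eqP; apply: contraT => /supp /andP[_ td]; exfalso.
  by apply: tx; exact: ltW (le_lt_trans td dx).
Qed.

(** The square of [phi] is nonnegative and its primitive is rescaled. *)
Lemma smooth_step (R : realType) (a b x0 : R) (phi : R -> R) :
  test_function a b phi -> phi x0 != 0 ->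
  exists H : R -> R, [/\ smooth H, forall x, 0 <= H x <= 1,
    forall x : R, x < -1 -> H x = 0 & forall x : R, 1 < x -> H x = 1].
Proof.
move=> /test_functionP[sphi [c [d [_ _ supp]]]] phix0.
have [cx0 x0d] := andP (supp _ phix0).
(* the support is widened by 1 on each side to have positive length *)
have [||||F [m [m0 sF F0m Fc Fd]]] :=
    @smooth_plateau _ (c - 1) (d + 1) x0 (fun x => phi x * phi x).
- exact: smoothM.
- by move=> x; rewrite -expr2 sqr_ge0.
- move=> x; rewrite mulf_eq0 orbb => /supp/andP[cx xd].
  by apply/andP; split; lra.
- by rewrite mulf_neq0.
pose k := (d - c) / 2 + 1.
have k0 : 0 < k by rewrite /k; lra.
exists (fun x => F (k * x + (c + d) / 2) * m^-1); split.
- by apply: smoothM; [exact: smooth_affine|exact: smooth_cst].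
- move=> x; have /andP[F0 Fm] := F0m (k * x + (c + d) / 2).
  by rewrite divr_ge0 ?(ltW m0)//= ler_pdivrMr// mul1r.
- move=> x x1; rewrite Fc ?mul0r//.
  have : k * x < - k by rewrite -mulrN1 ltr_pM2l.
  rewrite /k; lra.
- move=> x x1; rewrite Fd ?divff ?gt_eqF//.
  have : k < k * x by rewrite ltr_pMr.
  rewrite /k; lra.
Qed.

(** * The defect of the weak derivative identity *)

Lemma Rintegral_support (R : realType) (A B : set R) (h : R -> R) :
  A `<=` B -> (forall x, B x -> h x != 0 -> A x) ->
  \int[@lebesgue_measure R]_(x in B) h x =
  \int[@lebesgue_measure R]_(x in A) h x.
Proof.
move=> AB hA; rewrite [LHS]Rintegral_mkcond [RHS]Rintegral_mkcond.
apply: eq_Rintegral => x _; rewrite !patchE.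
case: ifPn => xB; case: ifPn => xA //.
  apply/eqP; move: xA; apply: contraNT => hx.
  by rewrite inE; apply: hA => //; rewrite -inE.
by exfalso; move: xB; rewrite notin_setE; apply; apply: AB; rewrite -inE.
Qed.

Lemma integrableM_continuous (R : realType) (a b : R) (h g : R -> R) :
  (@lebesgue_measure R).-integrable `[a, b] (EFin \o h) -> continuous g ->
  (@lebesgue_measure R).-integrable `]a, b[ (EFin \o (fun x => h x * g x)).
Proof.
move=> ih cg.
suff : (@lebesgue_measure R).-integrable `[a, b] (EFin \o (fun x => h x * g x)).
  by apply: integrableS => //; exact: subset_itv_oo_cc.
have := @integrableMl _ _ _ (@lebesgue_measure R) `[a, b] (measurable_itv _)
  (EFin \o h) g ih.
apply.
  by apply: measurable_funTS; exact: continuous_measurable_fun.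
have : compact (g @` `[a, b]%classic).
  apply: continuous_compact; last exact: segment_compact.
  exact: continuous_subspaceT.
move=> /compact_bounded[M [Mr HM]].
by exists M; split=> // N /HM hN x /= xab; apply: hN; exists x.
Qed.

Lemma test_functionS (R : realType) (a b a' b' : R) (phi : R -> R) :
  a <= a' -> b' <= b -> test_function a' b' phi -> test_function a b phi.
Proof.
move=> aa' bb' /test_functionP[sphi [c [d [ac db supp]]]].
apply/test_functionP; split=> //; exists c, d.
by split; [exact: le_lt_trans ac|exact: lt_le_trans bb'|].
Qed.

Lemma test_function_itv (R : realType) (a b : R) (phi : R -> R) :
  test_function a b phi -> (forall x, phi x != 0 -> x \in `]a, b[) /\
  (forall x, derive1 phi x != 0 -> x \in `]a, b[).
Proof.
move=> /test_functionP[sphi [c [d [ac db supp]]]].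
have {}db x : c <= x <= d -> x \in `]a, b[.
  by move=> /andP[cx xd]; rewrite in_itv/= (lt_le_trans ac)//= (le_lt_trans xd).
by split=> [x /supp|x /(derive1_eq0_outside supp)]; exact: db.
Qed.

(** Both sides of the weak derivative identity on one side: a linear functional
    of [phi], which can be evaluated piece by piece. *)
Definition defect (R : realType) (a b : R) (z dz phi : R -> R) : R :=
  \int[@lebesgue_measure R]_(t in `]a, b[) (z t * derive1 phi t) +
  \int[@lebesgue_measure R]_(t in `]a, b[) (dz t * phi t).

Lemma weak_derivativeP (R : realType) (a b : R) (z dz : R -> R) :
  weak_derivative a b z dz <->
  forall phi, test_function a b phi -> defect a b z dz phi = 0.
Proof.
split=> H phi /H; rewrite /defect; first by move=> ->; rewrite addNr.
by move/eqP; rewrite addr_eq0 => /eqP.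
Qed.

Lemma defect_sub (R : realType) (a b a' b' : R) (z dz phi : R -> R) :
  a <= a' -> b' <= b -> test_function a' b' phi ->
  defect a b z dz phi = defect a' b' z dz phi.
Proof.
move=> aa' bb' /test_function_itv[supp supp'].
have sub : `]a', b'[ `<=` `]a, b[ by apply: subset_itvW.
rewrite /defect; congr (_ + _); apply: Rintegral_support => // x _.
  by rewrite mulf_eq0 negb_or => /andP[_ /supp'].
by rewrite mulf_eq0 negb_or => /andP[_ /supp].
Qed.

Lemma defectD (R : realType) (a b : R) (z dz f g : R -> R) :
  (@lebesgue_measure R).-integrable `[a, b] (EFin \o z) ->
  (@lebesgue_measure R).-integrable `[a, b] (EFin \o dz) ->
  smooth f -> smooth g ->
  defect a b z dz (fun x => f x + g x) = defect a b z dz f + defect a b z dz g.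
Proof.
move=> iz idz sf sg; rewrite /defect addrACA.
have cd (h : R -> R) : smooth h -> continuous (derive1 h).
  by move=> sh; apply/smooth_continuous/smooth_derive.
congr (_ + _).
- rewrite -RintegralD//; [|exact: (integrableM_continuous iz (cd _ _))..].
  apply: eq_Rintegral => x _.
  by rewrite !derive1E deriveD ?mulrDr//; exact: smooth_derivable.
- rewrite -RintegralD//;
    [|exact: (integrableM_continuous idz (smooth_continuous _))..].
  by apply: eq_Rintegral => x _; rewrite mulrDr.
Qed.

Lemma Rintegral_derive_test (R : realType) (a b : R) (phi : R -> R) :
  a < b -> test_function a b phi ->
  \int[@lebesgue_measure R]_(t in `]a, b[) (derive1 phi t) = 0.
Proof.
move=> ab tphi; have [supp _] := test_function_itv tphi.
have [sphi _] := (test_functionP a b phi).1 tphi.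
have cd : continuous (derive1 phi) by apply/smooth_continuous/smooth_derive.
have end0 x : x \notin `]a, b[ -> phi x = 0.
  by move=> xab; apply/eqP; apply: contraNT xab => /supp.
rewrite /Rintegral -(@integral_itv_bndoo _ _ _ _ true false); last first.
  apply/measurable_EFinP.
  by apply: measurable_funTS; exact: continuous_measurable_fun.
rewrite (@continuous_FTC2 _ _ phi)//.
- by rewrite /= !end0 ?subr0// in_itv/= ltxx ?andbF.
- exact: continuous_subspaceT.
- split=> [x _||]; first exact: smooth_derivable.
  + exact/cvg_at_right_filter/smooth_continuous.
  + exact/cvg_at_left_filter/smooth_continuous.
Qed.

(** Bounds both terms of the defect of a function concentrated near one
    point. *)
Lemma normr_Rintegral_localized (R : realType) (a b : R)
    (A : set (measurableTypeR R)) (h g : R -> R) (B : R) :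
  measurable A -> A `<=` `]a, b[ ->
  (@lebesgue_measure R).-integrable `[a, b] (EFin \o h) -> continuous g ->
  (forall x, x \in `]a, b[ -> g x != 0 -> A x) -> (forall x, `|g x| <= B) ->
  `|\int[@lebesgue_measure R]_(t in `]a, b[) (h t * g t)| <=
  B * \int[@lebesgue_measure R]_(t in A) `|h t|.
Proof.
move=> mA Aab ih cg gA gB.
rewrite (@Rintegral_support _ A) => [|//|x]; last first.
  by move=> xab; rewrite mulf_eq0 negb_or => /andP[_]; exact: gA.
have ihA : (@lebesgue_measure R).-integrable A (EFin \o h).
  apply: integrableS ih => //.
  by apply: (subset_trans Aab); exact: subset_itv_oo_cc.
have ihgA : (@lebesgue_measure R).-integrable A (EFin \o (fun x => h x * g x)).
  by apply: integrableS (integrableM_continuous ih cg).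
apply: (le_trans (le_normr_Rintegral mA ihgA)).
have inh : (@lebesgue_measure R).-integrable A (EFin \o (fun x => `|h x|)).
  exact: (integrable_norm ihA).
rewrite -RintegralZl//; apply: le_Rintegral => //.
- exact: (integrable_norm ihgA).
- exact: (integrableZl _ B inh).
- by move=> x _; rewrite normrM mulrC ler_wpM2r.
Qed.

(** * Localization of the defect at the junction *)

Lemma absolutely_continuous_uniform (R : realType) (a b : R) (z : R -> R) :
  absolutely_continuous a b z -> forall e : R, 0 < e -> exists2 d : R, 0 < d &
    forall u v, a <= u <= b -> a <= v <= b -> `|u - v| < d ->
      `|z u - z v| < e.
Proof.
move=> acz e /acz[d d0 H]; exists d => // u v.
wlog uv : u v / v <= u => [wlg uab vab|].
  have [|/ltW] := leP v u; first by move=> *; exact: wlg.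
  by move=> *; rewrite distrC; apply: wlg; rewrite // distrC.
move=> /andP[au ub] /andP[av vb]; rewrite ger0_norm ?subr_ge0// => uvd.
(* the definition of absolute continuity for a single interval *)
have := H 1%N (fun=> v) (fun=> u); rewrite !big_ord1; apply => //.
by move=> i j _ _ _; rewrite !ord1.
Qed.

Lemma absolutely_continuous_integrable (R : realType) (a b : R) (z : R -> R) :
  absolutely_continuous a b z ->
  (@lebesgue_measure R).-integrable `[a, b] (EFin \o z).
Proof.
move=> /absolutely_continuous_uniform ucz.
apply: continuous_compact_integrable; first exact: segment_compact.
apply/subspace_continuousP => x /=; rewrite in_itv/= => xab.
apply/cvgrPdist_lt => e /ucz[d d0 H].
have : \forall y \near x, `|x - y| < d.
  by apply/nbhs_ballP; exists d => //= y; rewrite -ball_normE.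
apply: filterS => y /= xy; rewrite in_itv/= => yab; exact: H.
Qed.

Lemma integrable_small (R : realType) (a b : R) (h : R -> R) :
  (@lebesgue_measure R).-integrable `[a, b] (EFin \o h) ->
  forall e : R, 0 < e -> exists2 d : R, 0 < d &
  forall A : set (measurableTypeR R), measurable A ->
    A `<=` `[a, b] -> (@lebesgue_measure R A < d%:E)%E ->
    \int[@lebesgue_measure R]_(t in A) `|h t| < e.
Proof.
move=> ih e e0.
have /integral_normr_continuous/(_ e e0)[d [d0 H]] :
    (@lebesgue_measure R).-integrable setT (EFin \o (h \_ `[a, b])).
  by rewrite -restrict_EFin; apply/integrable_restrict => //=; rewrite setTI.
exists d => // A mA Aab /(H _ mA); apply: le_lt_trans.
rewrite le_eqVlt; apply/orP; left; apply/eqP.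
by apply: eq_Rintegral => x /[!inE] /Aab xab; rewrite patchE mem_set.
Qed.

(** For a step [H] from 0 to 1 this is 1 near the origin and 0 outside
    [[-3, 3]]. *)
Definition bump (R : realType) (H : R -> R) (s : R) : R :=
  H (s + 2) - H (s - 2).

(** The parts of [phi] to the left and to the right of the cut-off zone are test
    functions on the two subintervals, where the defect vanishes. *)
Lemma defect_localized (R : realType) (a t b : R) (z dz H phi : R -> R) :
  a <= t <= b ->
  (@lebesgue_measure R).-integrable `[a, b] (EFin \o z) ->
  (@lebesgue_measure R).-integrable `[a, b] (EFin \o dz) ->
  weak_derivative a t z dz -> weak_derivative t b z dz ->
  smooth H -> (forall x : R, x < -1 -> H x = 0) ->
  (forall x, 1 < x -> H x = 1) ->
  test_function a b phi -> forall k : R, 0 < k ->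
  defect a b z dz phi =
  defect a b z dz (fun x => phi x * bump H (k * x + - (k * t))).
Proof.
move=> /andP[at_ tb] iz idz wl wr sH H0 H1 tphi k k0.
have /test_functionP[sphi [c [d [ac db supp]]]] := tphi.
pose Hl x := H (k * x + (2 - k * t)).
pose Hr x := H (k * x + (- 2 - k * t)).
have sHl : smooth Hl := smooth_affine sH.
have sHr : smooth Hr := smooth_affine sH.
(* the parts left of t, right of t, and around t *)
pose l x := phi x * (1 - Hl x).
pose r x := phi x * Hr x.
pose m x := phi x * (Hl x - Hr x).
have sl : smooth l := smoothM sphi (smoothB (@smooth_cst R 1) sHl).
have sr : smooth r := smoothM sphi sHr.
have sm : smooth m := smoothM sphi (smoothB sHl sHr).
have -> : (fun x => phi x * bump H (k * x + - (k * t))) = m.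
  by apply/funext => x; rewrite /m /Hl /Hr /bump; congr (_ * (H _ - H _)); ring.
have phiE : phi = fun x => (l x + r x) + m x.
  by apply/funext => x; rewrite /l /r /m; ring.
have ki : 0 < k^-1 by rewrite invr_gt0.
(* l vanishes for x > t - 1 / k, and r for x < t + 1 / k *)
have tl : test_function a t l.
  apply/test_functionP; split=> //; exists c, (Num.min d (t - k^-1)).
  split=> //; first by rewrite gt_min ltrBlDr ltrDl ki orbT.
  move=> x; rewrite mulf_eq0 negb_or => /andP[/supp/andP[-> xd]] /= Hx.
  rewrite le_min xd/=; rewrite leNgt; apply: contra Hx => tx.
  apply/eqP; rewrite /Hl H1 ?subrr//.
  suff : -1 < k * (x - t) by rewrite mulrBr; lra.
  by rewrite mulrC -ltr_pdivrMr// mulN1r; lra.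
have tr : test_function t b r.
  apply/test_functionP; split=> //; exists (Num.max c (t + k^-1)), d.
  split=> //; first by rewrite lt_max ltrDl ki orbT.
  move=> x; rewrite mulf_eq0 negb_or => /andP[/supp/andP[cx xd]] Hx.
  rewrite ge_max cx xd/= andbT leNgt; apply: contra Hx => tx.
  apply/eqP; rewrite /Hr H0//.
  suff : k * (x - t) < 1 by rewrite mulrBr; lra.
  by rewrite mulrC -ltr_pdivlMr// mul1r; lra.
rewrite {1}phiE (defectD iz idz (smoothD sl sr) sm) (defectD iz idz sl sr).
rewrite (defect_sub z dz (lexx a) tb tl) (defect_sub z dz at_ (lexx b) tr).
have /weak_derivativeP -> := wl; last exact: tl.
by have /weak_derivativeP -> := wr; rewrite ?addr0 ?add0r.
Qed.

Lemma smooth_bump (R : realType) (H : R -> R) : smooth H -> smooth (bump H).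
Proof.
move=> sH.
rewrite (_ : bump H = fun s => H (1 * s + 2) - H (1 * s + - 2)).
  exact: (smoothB (smooth_affine sH) (smooth_affine sH)).
by apply/funext => s; rewrite /bump !mul1r.
Qed.

Lemma bump_support (R : realType) (H : R -> R) :
  (forall x : R, x < -1 -> H x = 0) -> (forall x, 1 < x -> H x = 1) ->
  forall s, bump H s != 0 -> -3 <= s <= 3.
Proof.
move=> H0 H1 s; rewrite /bump; apply: contra_neqT; rewrite negb_and -!ltNge.
by move=> /orP[s3|s3]; [rewrite !H0 ?subrr//; lra|rewrite !H1 ?subrr//; lra].
Qed.

Lemma lebesgue_measure_le_length (R : realType) (A : set (measurableTypeR R))
    (c d : R) : c <= d -> measurable A -> A `<=` `[c, d] ->
  (@lebesgue_measure R A <= (d - c)%:E)%E.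
Proof.
move=> cd mA Acd; apply: (@le_trans _ _ (@lebesgue_measure R `[c, d])).
  by apply: le_measure; rewrite ?inE.
by rewrite lebesgue_measure_itv/= lte_fin; case: ifPn => // _;
  rewrite lee_fin subr_ge0.
Qed.

(** With [m] the localized function, [m'] is of order [k] on an interval of
    length [6 / k]; as [m'] has integral 0, [z] can be replaced with [z - z t],
    which is at most [e] there, so the two scales cancel. The term with [dz] is
    bounded by absolute continuity of the integral. [C] depends neither on [e]
    nor on [k]. *)
Lemma defect_bump_small (R : realType) (a t b : R) (z dz H phi : R -> R) :
  a < b -> a <= t <= b -> absolutely_continuous a b z ->
  (@lebesgue_measure R).-integrable `[a, b] (EFin \o dz) ->
  smooth H -> (forall x, 0 <= H x <= 1) ->
  (forall x : R, x < -1 -> H x = 0) -> (forall x, 1 < x -> H x = 1) ->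
  test_function a b phi ->
  exists2 C : R, 0 <= C & forall e : R, 0 < e -> exists2 k : R, 0 < k &
    `|defect a b z dz (fun x => phi x * bump H (k * x + - (k * t)))| <= C * e.
Proof.
move=> ab tab acz idz sH H01 H0 H1 tphi.
have /test_functionP[sphi [c [d [ac db supp]]]] := tphi.
have iz := absolutely_continuous_integrable acz.
have sK := smooth_bump sH; have suppK := bump_support H0 H1.
have K1 s : `|bump H s| <= 1.
  have := H01 (s + 2); have := H01 (s - 2); rewrite /bump ler_norml; lra.
have [M [M0 HM]] := bounded_of_support (smooth_continuous sphi) supp.
have [M' [M'0 HM']] := bounded_of_support
  (smooth_continuous (smooth_derive sphi)) (derive1_eq0_outside supp).
have [C [C0 HC]] := bounded_of_support
  (smooth_continuous (smooth_derive sK)) (derive1_eq0_outside suppK).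
exists ((M * C + M') * 6 + M).
  by rewrite !(addr_ge0, mulr_ge0).
move=> e e0.
have [d1 d10 Hd1] := absolutely_continuous_uniform acz e0.
have [d2 d20 Hd2] := integrable_small idz e0.
(* 4 and 7 leave room above the half-width 3 / k and the length 6 / k *)
pose k := Num.max 1 (Num.max (4 / d1) (7 / d2)).
have k1 : 1 <= k by rewrite le_max lexx.
have k0 : 0 < k by exact: lt_le_trans k1.
have kd1 : 3 / k < d1.
  have : 4 <= k * d1 by rewrite -ler_pdivrMr// !le_max lexx !orbT.
  by rewrite ltr_pdivrMr//; lra.
have kd2 : 6 / k < d2.
  have : 7 <= k * d2 by rewrite -ler_pdivrMr// !le_max lexx !orbT.
  by rewrite ltr_pdivrMr//; lra.
exists k => //.
set m := fun x => _.
pose J : set (measurableTypeR R) := `[t - 3 / k, t + 3 / k]%classic.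
pose A : set (measurableTypeR R) := `]a, b[%classic `&` J.
have mA : measurable A by apply: measurableI; exact: measurable_itv.
have Aab : A `<=` `]a, b[ by exact: subIsetl.
have k30 : 0 < 3 / k by rewrite divr_gt0.
have muA : (@lebesgue_measure R A <= (6 / k)%:E)%E.
  have -> : 6 / k = t + 3 / k - (t - 3 / k) by ring.
  apply: lebesgue_measure_le_length => //; first by lra.
  exact: subIsetr.
have sKk : smooth (fun x => bump H (k * x + - (k * t))) by exact: smooth_affine.
have sm : smooth m := smoothM sphi sKk.
have suppm x : m x != 0 -> t - 3 / k <= x <= t + 3 / k.
  rewrite mulf_eq0 negb_or => /andP[_ /suppK/andP[h1 h2]].
  have : - (3 / k) <= x - t by rewrite -mulNr ler_pdivrMr// mulrC mulrBr.
  have : x - t <= 3 / k by rewrite ler_pdivlMr// mulrC mulrBr.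
  lra.
have tm : test_function a b m.
  apply/test_functionP; split=> //; exists c, d; split=> // x.
  by rewrite mulf_eq0 negb_or => /andP[/supp].
have Mm x : `|m x| <= M.
  by rewrite normrM -[M]mulr1 ler_pM.
have Mm' x : `|derive1 m x| <= k * (M * C + M').
  have -> : derive1 m x = phi x * (k * derive1 (bump H) (k * x + - (k * t)))
      + bump H (k * x + - (k * t)) * derive1 phi x.
    have h : is_derive x 1 (fun y => bump H (k * y + - (k * t))) _ :=
      is_derive_affine (smooth_derivable sK).
    rewrite derive1E (deriveM (smooth_derivable sphi) (smooth_derivable sKk)).
    by rewrite derive_val -derive1E.
  apply: (le_trans (ler_normD _ _)); rewrite mulrDr lerD//.
    rewrite !normrM mulrCA (gtr0_norm k0) ler_wpM2l ?(ltW k0)//.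
    by apply: ler_pM.
  rewrite normrM ler_pM// (le_trans (K1 _))//.
have cm' : continuous (derive1 m).
  exact/smooth_continuous/smooth_derive.
have icst (y : R) : (@lebesgue_measure R).-integrable `[a, b] (EFin \o cst y).
  apply: continuous_compact_integrable; first exact: segment_compact.
  exact/continuous_subspaceT/cst_continuous.
have Aabc : A `<=` `[a, b].
  by apply: (subset_trans Aab); exact: subset_itv_oo_cc.
(* the derivative of a test function has integral 0, so z may be recentred *)
have -> : defect a b z dz m =
  \int[@lebesgue_measure R]_(x in `]a, b[) ((z x - z t) * derive1 m x) +
  \int[@lebesgue_measure R]_(x in `]a, b[) (dz x * m x).
  congr (_ + _).
  under [RHS]eq_Rintegral do rewrite mulrBl.
  rewrite RintegralB//; last 2 first.
  - exact: (integrableM_continuous iz cm').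
  - exact: (integrableM_continuous (icst _) cm').
  rewrite RintegralZl//; last first.
    have im' : (@lebesgue_measure R).-integrable `[a, b] (EFin \o derive1 m).
      apply: continuous_compact_integrable; first exact: segment_compact.
      exact: continuous_subspaceT.
    by apply: integrableS im' => //; exact: subset_itv_oo_cc.
  by rewrite Rintegral_derive_test// mulr0 subr0.
apply: (le_trans (ler_normD _ _)); rewrite mulrDl lerD//.
- have iw : (@lebesgue_measure R).-integrable `[a, b]
      (EFin \o (fun x => z x - z t)).
    have := integrableB _ iz (icst (z t)) => /(_ (measurable_itv _)).
    by apply: eq_integrable => // x _; rewrite /= EFinB.
  apply: (le_trans (normr_Rintegral_localized mA Aab iw cm' _ Mm')).
    move=> x xab /(derive1_eq0_outside suppm) xt.
    by split=> //; rewrite /J/= in_itv.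
  rewrite [leRHS](_ : _ = k * (M * C + M') * (e * (6 / k))); last first.
    by field; rewrite gt_eqF.
  rewrite ler_wpM2l ?mulr_ge0 ?addr_ge0 ?mulr_ge0 ?(ltW k0)//.
  have finA : (@lebesgue_measure R A \is a fin_num)%E.
    by rewrite ge0_fin_numE// (le_lt_trans muA)// ltry.
  apply: (@le_trans _ _ (\int[@lebesgue_measure R]_(x in A) e)).
    apply: le_Rintegral => //.
    - apply: integrable_norm; apply: integrableS iw => //.
    - by apply: integrableS (icst e).
    - move=> x [/=]; rewrite /J/= !in_itv/= => /andP[ax xb] xt.
      by apply/ltW/Hd1; rewrite ?(ltW ax) ?(ltW xb)// ltr_distl; lra.
  rewrite Rintegral_cst// ler_wpM2l ?(ltW e0)//.
  by rewrite -lee_fin fineK.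
- apply: (le_trans (normr_Rintegral_localized mA Aab idz _ _ Mm)).
  + exact: smooth_continuous.
  + by move=> x xab /suppm xt; split=> //; rewrite /J/= in_itv.
  + rewrite ler_wpM2l// ltW// Hd2//.
    by apply: (le_lt_trans muA); rewrite lte_fin.
Qed.

(** * Pasting at a junction *)

(** Continuity of [z] at [t] is essential: a jump there would add a multiple of
    [phi t] to the defect. *)
Lemma weak_derivative_glue (R : realType) (a t b : R) (z dz : R -> R) :
  a <= t <= b -> absolutely_continuous a b z ->
  (@lebesgue_measure R).-integrable `[a, b] (EFin \o dz) ->
  weak_derivative a t z dz -> weak_derivative t b z dz ->
  weak_derivative a b z dz.
Proof.
move=> atb acz idz wl wr; apply/weak_derivativeP => phi tphi.
have [at_ tb] := andP atb.
(* a zero function is also a test function on the left part *)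
have [[x0 phix0]|phi0] := pselect (exists x0, phi x0 != 0); last first.
  have tl : test_function a t phi.
    have /test_functionP[sphi _] := tphi.
    apply/test_functionP; split=> //; exists (a + 1), (t - 1).
    split; rewrite ?ltrDl ?ltrBlDr ?ltrDl// => x phix.
    by exfalso; apply: phi0; exists x.
  rewrite (defect_sub z dz (lexx a) tb tl).
  by have /weak_derivativeP := wl; exact.
have ab : a < b.
  have := (test_function_itv tphi).1 x0 phix0.
  by rewrite in_itv/= => /andP[]; exact: lt_trans.
have [H [sH H01 H0 H1]] := smooth_step tphi phix0.
have [C C0 HC] := defect_bump_small ab atb acz idz sH H01 H0 H1 tphi.
have iz := absolutely_continuous_integrable acz.
apply/eqP; rewrite -normr_le0; apply/ler_addgt0Pr => e e0; rewrite add0r.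
have C1 : 0 < C + 1 by rewrite ltr_wpDl.
have [k k0] := HC (e / (C + 1)) (divr_gt0 e0 C1).
rewrite -(defect_localized atb iz idz wl wr sH H0 H1 tphi k0).
move=> /le_trans; apply.
rewrite mulrA ler_pdivrMr// mulrC ler_wpM2l ?(ltW e0)//.
by rewrite lerDl.
Qed.

(** Cut every interval at [t] by truncating its endpoints with [min] and [max]:
    this neither increases lengths nor creates overlaps. *)
Lemma absolutely_continuous_glue (R : realType) (a t b : R) (z : R -> R) :
  a <= t <= b ->
  absolutely_continuous a t z -> absolutely_continuous t b z ->
  absolutely_continuous a b z.
Proof.
move=> /andP[at_ tb] acl acr e e0.
have e20 : 0 < e / 2 by rewrite divr_gt0.
have [d1 d10 H1] := acl _ e20; have [d2 d20 H2] := acr _ e20.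
exists (Num.min d1 d2); first by rewrite lt_min d10.
move=> m l r lr dis; rewrite lt_min => /andP[s1 s2].
have le_min_r k : Num.min (r k) t - Num.min (l k) t <= r k - l k.
  by have [_ [? _]] := lr k; case: (leP (r k) t); case: (leP (l k) t); lra.
have le_max_r k : Num.max (r k) t - Num.max (l k) t <= r k - l k.
  by have [_ [? _]] := lr k; case: (leP (r k) t); case: (leP (l k) t); lra.
have K1 : \sum_(k < m) `|z (Num.min (r k) t) - z (Num.min (l k) t)| < e / 2.
  apply: H1.
  - move=> k; have [al [lek rb]] := lr k.
    split; first by rewrite le_min al.
    by split; [rewrite le_min !ge_min lek lexx orbT|rewrite ge_min lexx orbT].
  - move=> i j _ _ [x /= []]; rewrite !in_itv/= !gt_min !lt_min => xi xj.
    apply: dis => //; exists x; rewrite /= !in_itv/=.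
    move: xi xj => /andP[/orP[->|h] /andP[-> h']].
      by move=> /andP[/orP[->|k'] /andP[-> _]] //; lra.
    by move=> /andP[/orP[->|k'] /andP[-> _]] //; lra.
  - by apply: le_lt_trans s1; apply: ler_sum.
have K2 : \sum_(k < m) `|z (Num.max (r k) t) - z (Num.max (l k) t)| < e / 2.
  apply: H2.
  - move=> k; have [al [lek rb]] := lr k.
    split; first by rewrite le_max lexx orbT.
    by split; [rewrite ge_max !le_max lek lexx !orbT|rewrite ge_max rb].
  - move=> i j _ _ [x /= []]; rewrite !in_itv/= !gt_max !lt_max => xi xj.
    apply: dis => //; exists x; rewrite /= !in_itv/=.
    move: xi xj => /andP[/andP[-> h] /orP[->|h']].
      by move=> /andP[/andP[-> _] /orP[->|k']] //; lra.
    by move=> /andP[/andP[-> _] /orP[->|k']] //; lra.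
  - by apply: le_lt_trans s2; apply: ler_sum.
rewrite [e]splitr; apply: le_lt_trans (ltrD K1 K2).
rewrite -big_split/=; apply: ler_sum => k _.
have [_ [lek _]] := lr k.
have [rt|tr] := leP (r k) t.
  by rewrite (min_idPl (le_trans lek rt)) lerDl.
have [lt_|tl] := leP (l k) t; last by rewrite lerDr.
by rewrite addrC; apply: le_trans (ler_normD _ _); rewrite subrKA.
Qed.

(** The second interval is open at [t], so that a function pasted at [t] agrees
    with one of its pieces on each interval. *)
Lemma integrable_glue (R : realType) (a t b : R) (h : R -> R) :
  a <= t <= b ->
  (@lebesgue_measure R).-integrable `[a, t] (EFin \o h) ->
  (@lebesgue_measure R).-integrable `]t, b] (EFin \o h) ->
  (@lebesgue_measure R).-integrable `[a, b] (EFin \o h).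
Proof.
move=> /andP[at_ tb] il ir.
have /(integrable_mkcond _ _).1 := il => /(_ (measurable_itv _)) il'.
have /(integrable_mkcond _ _).1 := ir => /(_ (measurable_itv _)) ir'.
have ilr := integrableD measurableT il' ir'.
suff : (@lebesgue_measure R).-integrable `[a, b]
    ((EFin \o h) \_ `[a, t] \+ (EFin \o h) \_ `]t, b])%E.
  apply: eq_integrable => // x; rewrite inE/= in_itv/= => /andP[ax xb].
  rewrite !patchE; case: ifPn; rewrite ?inE ?notin_setE /= !in_itv/= => h1.
    have xt : (x \in `]t, b]%classic) = false.
      by apply/negP; rewrite inE/= in_itv/= ltNge; case/andP: h1 => _ ->.
    by rewrite xt adde0.
  rewrite mem_set ?add0e//= in_itv/= xb andbT ltNge.
  by apply/negP => xt; apply: h1; rewrite ax.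
exact: integrableS ilr.
Qed.

(** * Restriction and concatenation of trajectories *)

Lemma absolutely_continuousS (R : realType) (a b a' b' : R) (z : R -> R) :
  a <= a' -> b' <= b ->
  absolutely_continuous a b z -> absolutely_continuous a' b' z.
Proof.
move=> aa' b'b acz e /acz[d d0 H]; exists d => // m l r lr.
apply: H => k; have [al [-> rb]] := lr k.
by rewrite (le_trans aa' al) (le_trans rb b'b).
Qed.

Lemma L1S (R : realType) (n : nat) (a b a' b' : R) (u : R -> 'cV[R]_n) :
  a <= a' -> b' <= b -> L1 a b u -> L1 a' b' u.
Proof.
move=> aa' b'b iu i; apply: integrableS (iu i) => //.
exact: subset_itvScc.
Qed.

Lemma weak_derivativeS (R : realType) (a b a' b' : R) (z dz : R -> R) :
  a <= a' -> b' <= b -> weak_derivative a b z dz -> weak_derivative a' b' z dz.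
Proof.
move=> aa' b'b /weak_derivativeP wz; apply/weak_derivativeP => phi tphi.
rewrite -(defect_sub z dz aa' b'b tphi); apply: wz.
exact: test_functionS tphi.
Qed.

Lemma lebesgue_ae_filter (R : realType) :
  Filter (almost_everywhere (@lebesgue_measure R)).
Proof. exact: (ae_filter_ringOfSetsType (@lebesgue_measure R)). Qed.

(** The state constraint may be changed on the way: this is where the backward
    set and [X2] are exchanged. *)
Lemma feasibleS (R : realType) (nx nu : nat)
    (f : 'cV[R]_nx -> 'cV[R]_nu -> 'cV[R]_nu -> 'cV[R]_nx)
    (U2 : set 'cV[R]_nu) (X X' : R -> set 'cV[R]_nx) (u1 : R -> 'cV[R]_nu)
    (a b a' b' : R) (x : R -> 'cV[R]_nx) (u2 : R -> 'cV[R]_nu) :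
  a <= a' -> b' <= b -> (forall t, a' <= t <= b' -> X t (x t) -> X' t (x t)) ->
  feasible f U2 X u1 a b x u2 -> feasible f U2 X' u1 a' b' x u2.
Proof.
move=> aa' b'b XX' [Lu [dx [[acx Ldx wdx] ode U2u Xx]]].
have sub t : a' <= t <= b' -> a <= t <= b.
  by move=> /andP[h1 h2]; rewrite (le_trans aa' h1) (le_trans h2 b'b).
split; first exact: L1S Lu.
exists dx; split.
- split=> [i||i]; first exact: absolutely_continuousS (acx i).
    exact: L1S Ldx.
  exact: weak_derivativeS (wdx i).
- by apply: filterS ode => [|t H /sub/H //]; exact: lebesgue_ae_filter.
- by apply: filterS U2u => [|t H /sub/H //]; exact: lebesgue_ae_filter.
- by move=> t tab; apply: XX' => //; exact/Xx/sub.
Qed.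

Definition concat (R : realType) (V : Type) (t : R) (x y : R -> V) (s : R) :
    V :=
  if s <= t then x s else y s.

Lemma eq_absolutely_continuous (R : realType) (a b : R) (x y : R -> R) :
  (forall s, a <= s <= b -> x s = y s) ->
  absolutely_continuous a b x -> absolutely_continuous a b y.
Proof.
move=> xy acx e /acx[d d0 H]; exists d => // m l r lr dis small.
rewrite (eq_bigr (fun k => `|x (r k) - x (l k)|)); first exact: H.
move=> k _; have [al [lek rb]] := lr k.
by rewrite !xy// ?al ?rb ?(le_trans al lek) ?(le_trans lek rb).
Qed.

Lemma eq_weak_derivative (R : realType) (a b : R) (x y dx dy : R -> R) :
  (forall s, s \in `]a, b[ -> x s = y s) ->
  (forall s, s \in `]a, b[ -> dx s = dy s) ->
  weak_derivative a b x dx -> weak_derivative a b y dy.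
Proof.
move=> xy dxy wx phi /wx wphi; transitivity
    (\int[@lebesgue_measure R]_(t in `]a, b[) (x t * derive1 phi t)).
  by apply: eq_Rintegral => s; rewrite inE => sab; rewrite xy.
rewrite wphi; congr (- _).
by apply: eq_Rintegral => s; rewrite inE => sab; rewrite dxy.
Qed.

Lemma concatL (R : realType) (V : Type) (t : R) (x y : R -> V) (s : R) :
  s <= t -> concat t x y s = x s.
Proof. by rewrite /concat => ->. Qed.

Lemma concatR (R : realType) (V : Type) (t : R) (x y : R -> V) (s : R) :
  t < s -> concat t x y s = y s.
Proof. by rewrite /concat leNgt => ->. Qed.

Lemma L1_concat (R : realType) (n : nat) (a t b : R) (u v : R -> 'cV[R]_n) :
  a <= t <= b -> L1 a t u -> L1 t b v -> L1 a b (concat t u v).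
Proof.
move=> atb Lu Lv i; apply: (integrable_glue atb).
- apply: eq_integrable (Lu i) => // s.
  by rewrite inE/= in_itv/= => /andP[_ st]; rewrite /= concatL.
- have : (@lebesgue_measure R).-integrable `]t, b] (EFin \o (fun s => v s i 0)).
    by apply: integrableS (Lv i) => //; exact: subset_itv_oc_cc.
  apply: eq_integrable => // s.
  by rewrite inE/= in_itv/= => /andP[ts _]; rewrite /= concatR.
Qed.

Lemma W11_concat (R : realType) (n : nat) (a t b : R)
    (x dx y dy : R -> 'cV[R]_n) :
  a <= t <= b -> x t = y t -> W11 a t x dx -> W11 t b y dy ->
  W11 a b (concat t x y) (concat t dx dy).
Proof.
move=> atb xyt [acx Ldx wx] [acy Ldy wy].
have Ldz := L1_concat atb Ldx Ldy.
have acz i : absolutely_continuous a b (fun s => concat t x y s i 0).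
  apply: (absolutely_continuous_glue atb).
  - apply: eq_absolutely_continuous (acx i) => s /andP[_ st].
    by rewrite concatL.
  - apply: eq_absolutely_continuous (acy i) => s /andP[].
    rewrite le_eqVlt => /predU1P[<- _|ts _]; last by rewrite concatR.
    by rewrite concatL// xyt.
split=> // i; apply: (weak_derivative_glue atb (acz i) (Ldz i)).
- apply: eq_weak_derivative (wx i) => s;
    by rewrite in_itv/= => /andP[_ /ltW st]; rewrite concatL.
- apply: eq_weak_derivative (wy i) => s;
    by rewrite in_itv/= => /andP[ts _]; rewrite concatR.
Qed.

(** All conditions but [W11] are pointwise in time and pass from the pieces to
    the pasted trajectory. *)
Lemma feasible_concat (R : realType) (nx nu : nat)
    (f : 'cV[R]_nx -> 'cV[R]_nu -> 'cV[R]_nu -> 'cV[R]_nx)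
    (U2 : set 'cV[R]_nu) (X : R -> set 'cV[R]_nx) (u1 : R -> 'cV[R]_nu)
    (a t b : R) (x y : R -> 'cV[R]_nx) (u v : R -> 'cV[R]_nu) :
  a <= t <= b -> x t = y t ->
  feasible f U2 X u1 a t x u -> feasible f U2 X u1 t b y v ->
  feasible f U2 X u1 a b (concat t x y) (concat t u v).
Proof.
move=> atb xyt [Lu [dx [Wx odex Ux Xx]]] [Lv [dy [Wy odey Vy Xy]]].
split; first exact: L1_concat.
exists (concat t dx dy); split.
- exact: W11_concat.
- apply: filterS2 odex odey; first exact: lebesgue_ae_filter.
  move=> s odex odey /andP[as_ sb].
  have [st|ts] := leP s t; first by rewrite !concatL// odex// as_.
  by rewrite !concatR// odey// (ltW ts).
- apply: filterS2 Ux Vy; first exact: lebesgue_ae_filter.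
  move=> s Ux Vy /andP[as_ sb].
  have [st|ts] := leP s t; first by rewrite concatL//; apply: Ux; rewrite as_.
  by rewrite concatR//; apply: Vy; rewrite (ltW ts).
- move=> s /andP[as_ sb]; have [st|ts] := leP s t.
    by rewrite concatL//; apply: Xx; rewrite as_.
  by rewrite concatR//; apply: Xy; rewrite (ltW ts).
Qed.

Unset Implicit Arguments.

Theorem theorem1 (R : realType) (nx nu : nat) (T : R) (x0 : 'cV[R]_nx)
    (f : 'cV[R]_nx -> 'cV[R]_nu -> 'cV[R]_nu -> 'cV[R]_nx)
    (U2 : set 'cV[R]_nu) (X2 : R -> set 'cV[R]_nx)
    (T_gt0 : 0 < T)
    (u1 : R -> 'cV[R]_nu) (u1_L1 : L1 0 T u1)
    (t : R) (t_in : 0 <= t <= T) :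
  reachable_set T x0 f U2 X2 u1 t = forward_set T x0 f U2 X2 u1 t.
Proof.
have [t0 tT] := andP t_in.
apply/seteqP; split=> [_ [x [u2 [fx x_0]] <-]|xi [x [u2 [fx x_0 <-]]]].
  exists x, u2; split=> //; apply: (feasibleS _ _ _ fx) => // s /andP[s0 st] _.
  have sT := le_trans st tT.
  by exists x, u2; split=> //; apply: feasibleS fx.
(* the state constraint of the forward set, at the final time t *)
have Bt : backward_set T f U2 X2 u1 t (x t).
  by have [_ [dx [_ _ _]]] := fx; apply; rewrite t0 lexx.
have {}fx : feasible f U2 X2 u1 0 t x u2.
  apply: feasibleS fx => // s /andP[_ st] [y [v [[_ [dy [_ _ _ Xy]]] <-]]].
  by apply: Xy; rewrite lexx (le_trans st tT).
have [y [v [fy yt]]] := Bt.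
exists (concat t x y); last by rewrite concatL.
exists (concat t u2 v); split; last by rewrite concatL.
exact: feasible_concat.
Qed.
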